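(* Let $G$ be a subgroup of the symmetric group $S_m$, let $U$ and $V$ be unitary spaces, let $\mathfrak{X}$ be an irreducible unitary representation of $G$ over $U$, and let $S,T\in\mathrm{End}(V)$. Suppose $V^{\mathfrak{X}}(G)\neq\{0\}$. Then: (a) $K^{\mathfrak{X}}(T)=K^{\mathfrak{X}}(S)$ if and only if $T=S$; (b) $K^{\mathfrak{X}}(T)$ is invertible if and only if $T$ is invertible.
   Context: A unitary space is a finite-dimensional complex vector space equipped with an inner product. A unitary representation of $G$ over $U$ is a group homomorphism from $G$ to the unitary operators on $U$. $\times^{m}V$ is the Cartesian product of $m$ copies of $V$; $U\otimes\times^{m}V$ carries the inner product determined by $\langle u\otimes x^\times, v\otimes y^\times\rangle=\langle u,v\rangle\sum_{i=1}^m\langle x_i,y_i\rangle$. For $\sigma\in G$, $Q(\sigma)(v_1,\dots,v_m)=(v_{\sigma^{-1}(1)},\dots,v_{\sigma^{-1}(m)})$ on $\times^m V$, and $C_{\mathfrak{X}}=\frac{1}{|G|}\sum_{\sigma\in G}\mathfrak{X}(\sigma)\otimes Q(\sigma)$. The generalized Cartesian symmetry class is the range $V^{\mathfrak{X}}(G)=C_{\mathfrak{X}}(U\otimes\times^m V)$. For $T\in\mathrm{End}(V)$, $\times^mT$ is the operator on $\times^mV$ given by $(\times^mT)(v_1,\dots,v_m)=(Tv_1,\dots,Tv_m)$. The operator $I\otimes\times^mT$ commutes with $C_{\mathfrak{X}}$, so it leaves $V^{\mathfrak{X}}(G)$ invariant; its restriction to $V^{\mathfrak{X}}(G)$ is denoted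 $K^{\mathfrak{X}}(T)$ (the induced operator). *)

(* Defs.v *)
From HB Require Import structures.
From mathcomp Require Import all_boot all_order all_fingroup all_algebra.
From mathcomp Require Import sesquilinear.

Set Implicit Arguments.
Unset Strict Implicit.
Unset Printing Implicit Defensive.

Import GRing.Theory Num.Theory Num.Def VectorInternalTheory.
Local Open Scope ring_scope.

(* The tensor product of U and W, realised as the space of matrices of        *)
(* coordinates in the canonical bases of U and W; pure tensors are the        *)
(* rank-one matrices. Lemmas tens_ext and tens_lift are its universal         *)
(* property.                                                                  *)
Notation tensor U W := 'M_(dim U, dim W).

Section Tensor.
Variable (F : fieldType).
Implicit Types (U W Z : vectType F).

Definition tens U W (u : U) (w : W) : tensor U W := (v2r u)^T *m v2r w.

Lemma tens_linearl U W (w : W) : linear (fun u : U => tens u w).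
Proof. by move=> a u v; rewrite /tens !linearP mulmxDl -scalemxAl. Qed.

Lemma tens_linearr U W (u : U) : linear (fun w : W => tens u w).
Proof. by move=> a v w; rewrite /tens !linearP. Qed.

Lemma tens_delta U W (i : 'I_(dim U)) (j : 'I_(dim W)) :
  tens (r2v (delta_mx 0 i) : U) (r2v (delta_mx 0 j) : W) = delta_mx i j.
Proof. by rewrite /tens !r2vK trmx_delta mul_delta_mx. Qed.

Lemma tens_ext U W Z (f g : 'Hom(tensor U W, Z)) :
  (forall u w, f (tens u w) = g (tens u w)) -> f = g.
Proof.
move=> fg; apply/lfunP => M.
rewrite [M](matrix_sum_delta M) !linear_sum; apply: eq_bigr => i _.
rewrite !linear_sum; apply: eq_bigr => j _.
by rewrite !linearZ -tens_delta /= fg.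
Qed.

Lemma tens_lift U W Z (b : U -> W -> Z) :
    (forall w, linear (b^~ w)) -> (forall u, linear (b u)) ->
  exists f : 'Hom(tensor U W, Z), forall u w, f (tens u w) = b u w.
Proof.
move=> bl br.
pose e i : U := r2v (delta_mx 0 i); pose e' j : W := r2v (delta_mx 0 j).
pose h (M : tensor U W) : Z := \sum_i \sum_j M i j *: b (e i) (e' j).
have hl : linear h.
  move=> a M N; rewrite /h scaler_sumr -big_split; apply: eq_bigr => i _ /=.
  rewrite scaler_sumr -big_split; apply: eq_bigr => j _ /=.
  by rewrite !mxE scalerDl scalerA.
pose hL := GRing.isLinear.Build F (tensor U W) Z _ h hl.
pose hh : {linear tensor U W -> Z} := HB.pack h hL.
exists (linfun hh) => u w; rewrite lfunE /= /h.
have expand (X : vectType F) (x : X) : x = \sum_i v2r x 0 i *: r2v (delta_mx 0 i).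
  by apply: v2r_inj; rewrite linear_sum [LHS]row_sum_delta; apply: eq_bigr => i _;
     rewrite linearZ /= r2vK.
pose blL w := GRing.isLinear.Build F U Z _ (b^~ w) (bl w).
pose bll w : {linear U -> Z} := HB.pack (b^~ w) (blL w).
pose brL u := GRing.isLinear.Build F W Z _ (b u) (br u).
pose brr u : {linear W -> Z} := HB.pack (b u) (brL u).
rewrite [in RHS](expand _ u) -[RHS]/(bll w _) linear_sum; apply: eq_bigr => i _.
rewrite linearZ /= [in RHS](expand _ w) -[b _ _]/(brr (e i) _) linear_sum.
rewrite scaler_sumr; apply: eq_bigr => j _.
by rewrite linearZ /= scalerA /tens mxE big_ord1 !mxE.
Qed.

(* The operator A (x) B, see tens_lfunE. *)
Definition tens_lfun U W (A : 'End(U)) (B : 'End(W)) : 'End(tensor U W) :=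
  linfun (fun M : tensor U W => (lin1_mx (v2r \o A \o r2v))^T *m M
                                  *m lin1_mx (v2r \o B \o r2v) : tensor U W).

Lemma tens_lfunE U W (A : 'End(U)) (B : 'End(W)) u w :
  tens_lfun A B (tens u w) = tens (A u) (B w).
Proof.
rewrite /tens_lfun; set h := (X in linfun X).
have hl : linear h.
  by move=> a M N; rewrite /h mulmxDr mulmxDl -scalemxAr -scalemxAl.
pose hL := GRing.isLinear.Build F (tensor U W) (tensor U W) _ h hl.
rewrite (lfunE (HB.pack h hL : {linear tensor U W -> tensor U W})) /= /h /tens.
have E (X : vectType F) (D : 'End(X)) (x : X) :
    v2r x *m lin1_mx (v2r \o D \o r2v) = v2r (D x).
  by rewrite mul_rV_lin1 /= v2rK.
by rewrite !mulmxA -trmx_mul E -mulmxA E.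
Qed.

End Tensor.

Section LinearOperators.
Variable (F : fieldType).
Implicit Types (V : vectType F).

Definition invertible_lfun V (f : 'End(V)) : Prop :=
  exists g : 'End(V), (g \o f)%VF = \1%VF /\ (f \o g)%VF = \1%VF.

(* The restriction of f to W; it is meant for f leaving W invariant, so that  *)
(* the projection vsproj onto W does nothing (vsval_restrict_lfun).           *)
Definition restrict_lfun V (W : {vspace V}) (f : 'End(V)) : 'End(subvs_of W) :=
  (linfun (vsproj W) \o f \o linfun vsval)%VF.

Lemma vsval_restrict_lfun V (W : {vspace V}) (f : 'End(V)) (w : subvs_of W) :
  (f @: W <= W)%VS -> vsval (restrict_lfun W f w) = f (vsval w).
Proof.
move=> /subvP fW; rewrite !comp_lfunE !lfunE /= vsprojK //.
by apply/fW/memv_img/subvsP.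
Qed.

End LinearOperators.

Section Representation.
Variables (C : numClosedFieldType) (U : vectType C) (gT : finGroupType).
Implicit Types (G : {group gT}) (X : gT -> 'End(U)).

Definition unitary_lfun (dot : {dot U for conjC}) (A : 'End(U)) : Prop :=
  (forall u v, dot (A u) (A v) = dot u v) /\ invertible_lfun A.

(* Only the values of X on G matter. For permutations, MathComp's s * t means *)
(* "s, then t"; a homomorphism for the usual product of permutations (the     *)
(* composition s \o t, that is t * s here) thus satisfies                     *)
(* X (t * s) = X s \o X t.                                                    *)
Definition unitary_repr G (dot : {dot U for conjC}) X : Prop :=
  (forall s, s \in G -> unitary_lfun dot (X s)) /\
  (forall s t, s \in G -> t \in G -> X (t * s)%g = (X s \o X t)%VF).

Definition irreducible_repr G X : Prop :=
  (fullv : {vspace U}) != 0%VS /\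
  forall W : {vspace U}, (forall s, s \in G -> (X s @: W <= W)%VS) ->
    W = 0%VS \/ W = fullv.

End Representation.

Section CartesianSymmetryClass.
Variables (C : numClosedFieldType) (m : nat) (U V : vectType C).
Implicit Types (G : {group 'S_m}) (X : 'S_m -> 'End(U)) (T : 'End(V)).

Definition cart_perm (s : 'S_m) : 'End({ffun 'I_m -> V}) :=
  linfun (fun v : {ffun 'I_m -> V} => [ffun i => v ((s^-1)%g i)]).

Definition cart_lfun T : 'End({ffun 'I_m -> V}) :=
  linfun (fun v : {ffun 'I_m -> V} => [ffun i => T (v i)]).

Lemma cart_permE s v i : cart_perm s v i = v ((s^-1)%g i).
Proof.
rewrite /cart_perm; set h := (X in linfun X).
have hl : linear h by move=> a x y; apply/ffunP => j; rewrite !ffunE.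
pose hL := GRing.isLinear.Build C {ffun 'I_m -> V} {ffun 'I_m -> V} _ h hl.
rewrite (lfunE (HB.pack h hL : {linear {ffun 'I_m -> V} -> {ffun 'I_m -> V}})).
by rewrite /= ffunE.
Qed.

Lemma cart_lfunE T v i : cart_lfun T v i = T (v i).
Proof.
rewrite /cart_lfun; set h := (X in linfun X).
have hl : linear h by move=> a x y; apply/ffunP => j; rewrite !ffunE linearP.
pose hL := GRing.isLinear.Build C {ffun 'I_m -> V} {ffun 'I_m -> V} _ h hl.
rewrite (lfunE (HB.pack h hL : {linear {ffun 'I_m -> V} -> {ffun 'I_m -> V}})).
by rewrite /= ffunE.
Qed.

Definition symmetrizer G X : 'End(tensor U {ffun 'I_m -> V}) :=
  #|G|%:R^-1 *: \sum_(s in G) tens_lfun (X s) (cart_perm s).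

Definition symmetry_class G X : {vspace tensor U {ffun 'I_m -> V}} :=
  limg (symmetrizer G X).

Definition induced_op G X T : 'End(subvs_of (symmetry_class G X)) :=
  restrict_lfun (symmetry_class G X) (tens_lfun \1%VF (cart_lfun T)).

Arguments induced_op : clear implicits.

Lemma symmetrizer_comm G X T :
  (tens_lfun \1 (cart_lfun T) \o symmetrizer G X =
   symmetrizer G X \o tens_lfun \1 (cart_lfun T))%VF.
Proof.
apply: tens_ext => u w; rewrite !comp_lfunE tens_lfunE id_lfunE !scale_lfunE.
rewrite linearZ !sum_lfunE linear_sum; congr (_ *: _); apply: eq_bigr => s _.
rewrite /= !tens_lfunE id_lfunE; congr tens; apply/ffunP => i.
by rewrite cart_lfunE !cart_permE cart_lfunE.
Qed.

Lemma induced_opE G X T (z : subvs_of (symmetry_class G X)) :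
  vsval (induced_op G X T z) = tens_lfun \1%VF (cart_lfun T) (vsval z).
Proof.
apply: vsval_restrict_lfun.
by rewrite /symmetry_class -limg_comp symmetrizer_comm limg_comp limgS ?subvf.
Qed.

End CartesianSymmetryClass.

Arguments symmetry_class {C m U} V G X.
Arguments induced_op {C m U V} G X T.

(* Main.v *)
From HB Require Import structures.
Require Import Defs.
From mathcomp Require Import all_boot all_fingroup all_algebra.
From mathcomp Require Import sesquilinear complex boolp reals.
Import GRing.Theory Num.Theory VectorInternalTheory.

Set Implicit Arguments.
Unset Strict Implicit.
Unset Printing Implicit Defensive.

Local Open Scope ring_scope.

(** The operators [Q(s)] permute the factors of [V^m] without touching [V].
    Under [U (x) V^m = (U (x) C^m) (x) V], the symmetrizer is therefore
    [c (x) 1] for an operator [c] on [U (x) C^m], the symmetry class is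
    [limg c (x) V], and the induced operator of [T] is [1 (x) T]. When the
    class is nonzero, so is [limg c], hence [V] embeds in the class by
    [v |-> y (x) v] for some [y != 0] in [limg c], and this embedding
    intertwines [T] with the induced operator of [T], for all [T] at once.

    The embedding is obtained in [symmetry_class_embedding] as
    [v |-> C_X (u (x) (0, .., v, .., 0))], with no appeal to the
    regrouped tensor product: every coordinate slice of this tensor is a scalar
    multiple of [v] ([slice_symmetrizer]), and some such scalar is nonzero
    because the tensors [u (x) (0, .., v, .., 0)] span the domain of [C_X].

    Both cancellation properties follow: [T] can be read off its induced
    operator on the image of [V], and it is injective as soon as the induced
    operator is. The converse of invertibility is functoriality of
    [T |-> induced_op G X T]. *)

Section CartesianProduct.
Variables (C : numClosedFieldType) (m : nat) (V : vectType C).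
Implicit Types (v : V) (w : {ffun 'I_m -> V}) (i j : 'I_m).

Definition single i v : {ffun 'I_m -> V} := [ffun j => if j == i then v else 0].

Lemma sum_single w : w = \sum_i single i (w i).
Proof.
apply/ffunP => j; rewrite sum_ffunE (bigD1 j) //= ffunE eqxx big1 ?addr0 //.
by move=> i /negPf ij; rewrite ffunE eq_sym ij.
Qed.

Lemma cart_lfun_single (T : 'End(V)) i v :
  cart_lfun m T (single i v) = single i (T v).
Proof.
by apply/ffunP => j; rewrite cart_lfunE !ffunE; case: eqP; rewrite ?linear0.
Qed.

Lemma cart_perm_single (s : 'S_m) i v :
  cart_perm V s (single i v) = single (s i) v.
Proof.
apply/ffunP => j; rewrite cart_permE !ffunE; congr (if _ then _ else _).
by rewrite -(inj_eq (@perm_inj _ s)) permKV.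
Qed.

Lemma cart_lfun1 : cart_lfun m (\1%VF : 'End(V)) = \1%VF.
Proof.
by apply/lfunP => w; apply/ffunP => i; rewrite cart_lfunE !id_lfunE.
Qed.

Lemma cart_lfun_comp (A B : 'End(V)) :
  cart_lfun m (A \o B)%VF = (cart_lfun m A \o cart_lfun m B)%VF.
Proof.
by apply/lfunP => w; apply/ffunP => i; rewrite comp_lfunE !cart_lfunE comp_lfunE.
Qed.

End CartesianProduct.

Section TensorOperators.
Variables (F : fieldType) (U W : vectType F).

Lemma tens_sumr I (r : seq I) (u : U) (w : I -> W) :
  tens u (\sum_(i <- r) w i) = \sum_(i <- r) tens u (w i).
Proof. by rewrite /tens linear_sum mulmx_sumr. Qed.

Lemma tens_lfun1 : tens_lfun (\1%VF : 'End(U)) (\1%VF : 'End(W)) = \1%VF.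
Proof. by apply: tens_ext => u w; rewrite tens_lfunE !id_lfunE. Qed.

Lemma tens_lfun_comp (A A' : 'End(U)) (B B' : 'End(W)) :
  tens_lfun (A \o A')%VF (B \o B')%VF = (tens_lfun A B \o tens_lfun A' B')%VF.
Proof. by apply: tens_ext => u w; rewrite comp_lfunE !tens_lfunE !comp_lfunE. Qed.

End TensorOperators.

Section Slices.
Variables (C : numClosedFieldType) (m : nat) (U V : vectType C).
Local Notation Vm := {ffun 'I_m -> V}.

(** This is the contraction [x (x) w |-> x_k w_j], where [x_k] is the [k]-th
    coordinate of [x]. *)
Definition slice (k : 'I_(dim U)) (j : 'I_m) (M : tensor U Vm) : V :=
  (r2v (row k M) : Vm) j.

Lemma slice_linear k j : linear (slice k j).
Proof. by move=> a M N; rewrite /slice !linearP !ffunE. Qed.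

HB.instance Definition _ k j :=
  GRing.isLinear.Build C (tensor U Vm) V _ (slice k j) (slice_linear k j).

Lemma slice_tens k j (u : U) (w : Vm) :
  slice k j (tens u w) = v2r u 0 k *: w j.
Proof.
rewrite /slice /tens row_mul.
have -> : row k (v2r u)^T =
          (v2r u 0 k)%:M.
  by apply/matrixP => a b; rewrite !ord1 !mxE eqxx mulr1n.
by rewrite mul_scalar_mx linearZ /= v2rK ffunE.
Qed.

Lemma slice_eq0 (M : tensor U Vm) : (forall k j, slice k j M = 0) -> M = 0.
Proof.
move=> M0; apply/row_matrixP => k; rewrite row0.
apply: (can_inj (@r2vK _ Vm)); rewrite linear0.
by apply/ffunP => j; rewrite ffunE; apply: M0.
Qed.

End Slices.

Section InducedOperators.
Variables (C : numClosedFieldType) (m : nat) (U V : vectType C).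
Variables (G : {group 'S_m}) (X : 'S_m -> 'End(U)).
Local Notation Vm := {ffun 'I_m -> V}.
Local Notation CX := (symmetrizer V G X).

(** With [c] the operator on [U (x) C^m] such that the symmetrizer is
    [c (x) 1], these are the coordinates of [c (u (x) e_i)]. *)
Definition symmetrizer_coef (u : U) (i : 'I_m) (k : 'I_(dim U)) (j : 'I_m) : C :=
  #|G|%:R^-1 * \sum_(s in G | s i == j) v2r (X s u) 0 k.

Lemma slice_symmetrizer u i k j (v : V) :
  slice k j (CX (tens u (single i v))) = symmetrizer_coef u i k j *: v.
Proof.
rewrite scale_lfunE linearZ /= sum_lfunE linear_sum -scalerA scaler_suml.
congr (_ *: _); rewrite big_mkcondr; apply: eq_bigr => s _ /=.
rewrite tens_lfunE cart_perm_single slice_tens ffunE eq_sym.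
by case: eqP; rewrite ?scaler0.
Qed.

Lemma symmetrizer_coef_neq0 :
  symmetry_class V G X != 0%VS -> exists u i k j, symmetrizer_coef u i k j != 0.
Proof.
move=> CX_neq0; apply: contrapT => coef0.
have {CX_neq0} : CX != 0.
  by apply: contra CX_neq0 => /eqP CX0; rewrite /symmetry_class CX0 lim0g.
case/eqP; apply: tens_ext => u w.
rewrite zero_lfunE (sum_single w) tens_sumr linear_sum big1 // => i _ /=.
apply: slice_eq0 => k j; rewrite slice_symmetrizer.
have [->|c_neq0] := eqVneq (symmetrizer_coef u i k j) 0; first by rewrite scale0r.
by case: coef0; exists u, i, k, j.
Qed.

(** Fixing [u] and [i] that carry a nonzero coefficient, a slice recovers [v]
    from [C_X (u (x) single i v)] up to that coefficient. The intertwining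
    holds because the symmetrizer commutes with [1 (x) T]. *)
Lemma symmetry_class_embedding :
    symmetry_class V G X != 0%VS ->
  exists2 f : V -> subvs_of (symmetry_class V G X), injective f &
    forall (T : 'End(V)) v, induced_op G X T (f v) = f (T v).
Proof.
case/symmetrizer_coef_neq0 => u [i [k [j c_neq0]]].
pose f v := vsproj (symmetry_class V G X) (CX (tens u (single i v))).
have val_f v : vsval (f v) = CX (tens u (single i v)).
  by rewrite vsprojK // memv_img ?memvf.
exists f => [v v' /(congr1 vsval)|T v].
  rewrite !val_f => /(congr1 (slice k j)); rewrite !slice_symmetrizer.
  exact: scalerI.
apply: val_inj; rewrite /= induced_opE !val_f -comp_lfunE symmetrizer_comm.
by rewrite comp_lfunE tens_lfunE id_lfunE cart_lfun_single.
Qed.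

Lemma induced_op1 : induced_op G X (\1%VF : 'End(V)) = \1%VF.
Proof.
apply/lfunP => z; apply: val_inj.
by rewrite /= induced_opE cart_lfun1 tens_lfun1 !id_lfunE.
Qed.

Lemma induced_op_comp (A B : 'End(V)) :
  induced_op G X (A \o B)%VF = (induced_op G X A \o induced_op G X B)%VF.
Proof.
apply/lfunP => z; apply: val_inj; rewrite /= comp_lfunE !induced_opE.
by rewrite cart_lfun_comp -comp_lfunE -tens_lfun_comp comp_lfun1l.
Qed.

Lemma induced_op_invertible (T : 'End(V)) :
  invertible_lfun T -> invertible_lfun (induced_op G X T).
Proof.
case=> T' [T'T TT']; exists (induced_op G X T').
by rewrite -!induced_op_comp T'T TT' induced_op1.
Qed.

End InducedOperators.

Lemma injective_lfun_invertible (F : fieldType) (V : vectType F) (f : 'End(V)) :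
  injective f -> invertible_lfun f.
Proof.
move=> /lker0P f_inj.
by exists (f^-1)%VF; rewrite lker0_compVf ?lker0_compfV.
Qed.

Lemma invertible_lfun_inj (F : fieldType) (V : vectType F) (f : 'End(V)) :
  invertible_lfun f -> injective f.
Proof.
case=> g [gf _]; apply: (can_inj (g := g)) => v.
by rewrite -comp_lfunE gf id_lfunE.
Qed.

Theorem theorem3p1 (R : realType) (m : nat) (G : {group 'S_m})
    (U V : vectType R[i])
    (dotU : {dot U for Num.conj}) (dotV : {dot V for Num.conj})
    (X : 'S_m -> 'End(U))
    (X_unitary : unitary_repr G dotU X) (X_irr : irreducible_repr G X)
    (S T : 'End(V))
    (VXG_neq0 : symmetry_class V G X != 0%VS) :
  (induced_op G X T = induced_op G X S <-> T = S) /\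
  (invertible_lfun (induced_op G X T) <-> invertible_lfun T).
Proof.
have [f f_inj fE] := symmetry_class_embedding VXG_neq0.
split; split.
- by move=> KTS; apply/lfunP => v; apply: f_inj; rewrite -!fE KTS.
- by move=> ->.
- move=> /invertible_lfun_inj KT_inj.
  apply: injective_lfun_invertible => v v' Tvv'.
  by apply/f_inj/KT_inj; rewrite !fE Tvv'.
- exact: induced_op_invertible.
Qed.
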